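(* Let $q\in[2,\infty)$, let $q^*:=q/(q-1)$, and let $p\in[q^*,\infty)$. Then $$\frac{\pi_{p,q}^2-x^2}{\pi_{p,q}^2+x^2}<\left(\cos_{p,q}\frac{x}{2}\right)^{p-1}\qquad\text{for all }x\in(0,\pi_{p,q}).$$ In particular, for every $p\in[2,\infty)$, $$\frac{\pi_{p}^2-x^2}{\pi_{p}^2+x^2}<\left(\cos_{p}\frac{x}{2}\right)^{p-1}\qquad\text{for all }x\in(0,\pi_{p}).$$
   Context: For $p,q\in(1,\infty)$ define $F_{p,q}(x):=\int_0^x\frac{dt}{(1-t^q)^{1/p}}$ for $x\in[0,1]$, and $$\pi_{p,q}:=2F_{p,q}(1)=2\int_0^1\frac{dt}{(1-t^q)^{1/p}} .$$ The generalized sine function $\sin_{p,q}$ is defined on $[0,\pi_{p,q}/2]$ as the inverse function of $F_{p,q}$ (an increasing function from $[0,\pi_{p,q}/2]$ onto $[0,1]$); it is extended to $(\pi_{p,q}/2,\pi_{p,q}]$ by $\sin_{p,q}x:=\sin_{p,q}(\pi_{p,q}-x)$, and then to all of $\mathbb{R}$ as the odd $\pi_{p,q}$-antiperiodic continuation. The resulting function is in $C^1(\mathbb{R})$, and the generalized cosine function is $\cos_{p,q}x:=(\sin_{p,q}x)'$, where ${}'=d/dx$. One has $|\cos_{p,q}x|^p+|\sin_{p,q}x|^q=1$, and $\cos_{p,q}$ is positive on $(0,\pi_{p,q}/2)$. When $q=p$, one writes $\sin_p:=\sin_{p,p}$, $\cos_p:=\cos_{p,p}$ and $\pi_p:=\pi_{p,p}$.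 *)

(* Defs.v *)
From HB Require Import structures.
From mathcomp Require Import all_boot all_order all_algebra.
From mathcomp Require Import all_classical all_reals all_analysis.
Import Order.TTheory GRing.Theory Num.Theory.
Import numFieldNormedType.Exports.

Set Implicit Arguments.
Unset Strict Implicit.
Unset Printing Implicit Defensive.

Local Open Scope classical_set_scope.
Local Open Scope ring_scope.

Section generalized_trigonometric_functions.
Context {R : realType}.
Implicit Types p q x : R.

(* For p, q > 1 the integrand is Lebesgue integrable on [0, 1], so the
   Lebesgue integral agrees with the improper Riemann integral at x = 1; the
   value 0^-1 = 0 of the integrand at t = 1 is irrelevant. *)
Definition Fpq p q x : R :=
  \int[lebesgue_measure]_(t in `[0, x]) ((1 - t `^ q) `^ p^-1)^-1.

Definition pipq p q : R := 2 * Fpq p q 1.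

Definition invFpq p q : R -> R := 'pinv_(fun=> 0) `[0, 1] (Fpq p q).

Definition sinpq0 p q x : R :=
  if x <= pipq p q / 2 then invFpq p q x
  else invFpq p q (pipq p q - x).

(* The pi_{p,q}-antiperiodic continuation from [0, pi_{p,q}] to the real line:
   sin (y + k pi_{p,q}) = (-1)^k sin y for y in [0, pi_{p,q}) and k an integer.
   It is odd because sinpq0 is symmetric about pi_{p,q} / 2 and vanishes at the
   endpoints, so oddness need not be imposed separately. *)
Definition sinpq p q x : R :=
  let k := Num.floor (x / pipq p q) in
  (-1) ^ k * sinpq0 p q (x - k%:~R * pipq p q).

Definition cospq p q : R -> R := derive1 (sinpq p q).

Definition pip p : R := pipq p p.

Definition cosp p : R -> R := cospq p p.

End generalized_trigonometric_functions.

(* Main.v *)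
(* Put a = F(1) and r = p / (p - 1) <= q.  For y = F(s) the right-hand side
   (cos_{p,q} y)^(p-1) is (1 - s^q)^(1/r); write it cos t with t in (0, pi/2), so
   that s = (1 - cos^r t)^(1/q) and y becomes a function of t with y(0) = 0,
   y(pi/2) = a and
     (q/r) y'(t) = k(t) := (1 - cos^r t)^(-b) sin t,     b = 1 - 1/q.
   Two facts imply the inequality.
   - tan(t/2) < 2t/pi, and cos t = (1 - tan^2(t/2)) / (1 + tan^2(t/2)); this is the
     inequality for p = q = 2.
   - y(t) / a >= t / (pi/2).  Once k(u) > 1, k(t) >= k(u) for all t < u, while the
     mean of k over (0, pi/2) is at least 1.  If y were below its chord somewhere,
     the mean value theorem on both sides would give points t < u with
     k(t) < mean < k(u). *)
Require Import Defs.
From mathcomp Require Import all_boot all_order all_algebra.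
From mathcomp Require Import all_classical all_reals all_analysis.
From mathcomp Require Import measurable_realfun.
From mathcomp Require Import ring lra.
Import Order.TTheory GRing.Theory Num.Theory.
Import numFieldNormedType.Exports.
Local Open Scope classical_set_scope.
Local Open Scope ring_scope.

(** * Real powers and the integrable majorant *)

Lemma powR_itv_oo01 {R : realType} (a x : R) : 0 < a -> 0 < x < 1 -> 0 < x `^ a < 1.
Proof.
move=> a0 /andP[x0 x1]; rewrite powR_gt0//=.
have : x `^ a < 1 `^ a by rewrite gt0_ltr_powR ?nnegrE ?ler01 ?(ltW x0).
by rewrite powR1.
Qed.

Lemma is_derive1_powR_comp {R : realType} (g : R -> R) (a x dg : R) : 0 < g x ->
  is_derive x 1 g dg ->
  is_derive x 1 (fun t => g t `^ a) (a * g x `^ (a - 1) * dg).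
Proof.
move=> gx0 dgx.
exact: (@is_derive1_comp _ (fun y => y `^ a) g x _ _ (is_derive1_powR a gx0)).
Qed.

Lemma is_derive1_onem_powR {R : realType} (a t : R) : t < 1 ->
  is_derive t 1 (fun t => (1 - t) `^ a) (- (a * (1 - t) `^ (a - 1))).
Proof.
move=> t1; have t1' : 0 < 1 - t by rewrite subr_gt0.
have dB : is_derive t 1 (fun t : R => 1 - t) (0 - 1) by exact: is_deriveB.
by have := is_derive1_powR_comp (fun t => 1 - t) a _ _ t1' dB; rewrite sub0r mulrN1.
Qed.

(** Provides the majorant for the integrand of [Fpq]. On [[0, b n]] the antiderivative [G] bounds
    the integral by 1/(1 - a), uniformly in n; monotone convergence carries the bound to [0, 1[. *)
Lemma integrable_onem_powRN {R : realType} (a : R) : 0 < a < 1 ->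
  lebesgue_measure.-integrable `[0, 1] (EFin \o (fun t : R => (1 - t) `^ (- a))).
Proof.
move=> /andP[a0 a1].
set g := fun t : R => (1 - t) `^ (- a).
have mg D : measurable_fun D g.
  apply: (@measurable_funS _ _ _ _ setT) => //.
  apply: (measurableT_comp (measurable_powR _)).
  exact: measurable_funB.
have mg' D : measurable_fun D (EFin \o g) by exact/measurable_EFinP.
have g0 t : 0 <= g t by exact: powR_ge0.
apply/integrableP; split; first exact: mg'.
under eq_integral do rewrite /= ger0_norm//.
rewrite -integral_itv_bndo_bndc//.
(* The shift [n.+2] makes [b 0] positive, so that every [[0, b n]] is a nondegenerate interval for
   the fundamental theorem of calculus. *)
pose b n : R := 1 - n.+2%:R^-1.
have b01 n : 0 < b n < 1.
  rewrite subr_gt0 invf_lt1 ?ltr0n// ltr1n/=.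
  by rewrite /b ltrBlDr ltrDl invr_gt0 ltr0n.
have -> : `[0, 1[%classic = \bigcup_n `[0, b n]%classic.
  apply/seteqP; split => [x /=|x [n _] /=].
    rewrite in_itv/= => /andP[x0 x1].
    have : \forall n \near \oo, (n.+1%:R^-1 : R) < 1 - x.
      by apply: near_infty_natSinv_lt (PosNum _); rewrite subr_gt0.
    case=> N _ /(_ N (leqnn _)) /= HN; exists N => //=.
    rewrite in_itv/= x0 /b/= lerBrDr -lerBrDl ltW// (le_lt_trans _ HN)//.
    by rewrite lef_pV2 ?posrE ?ltr0n// ler_nat.
  rewrite !in_itv/= => /andP[-> /le_lt_trans]; apply.
  by have /andP[] := b01 n.
have cvgI : (\int[lebesgue_measure]_(x in `[0%R, b i]) (g x)%:E @[i --> \oo]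
   --> \int[lebesgue_measure]_(x in \bigcup_i `[0%R, b i]%classic) (g x)%:E)%E.
  apply: ge0_nondecreasing_set_cvg_integral => //.
  - move=> n m nm; apply/subsetPset; apply: subset_itvl => /=.
    rewrite bnd_simp /b lerB// lef_pV2 ?posrE ?ltr0n// ler_nat !ltnS//.
  - by move=> i; exact: mg'.
  - by move=> i x _; rewrite lee_fin.
rewrite -(cvg_lim _ cvgI)//.
apply: (@le_lt_trans _ _ ((1 - a)^-1)%:E); last by rewrite ltry.
apply: lime_le; first by apply/cvg_ex; eexists; exact: cvgI.
apply: nearW => n.
have /andP[bn0 bn1] := b01 n.
pose G (t : R) : R := - ((1 - a)^-1 * (1 - t) `^ (1 - a)).
have dG (t : R) : t < 1 -> is_derive t 1 G (g t).
  move=> t1.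
  have := is_deriveN (is_deriveZ (1 - a)^-1 (is_derive1_onem_powR (1 - a) t t1)).
  rewrite /GRing.scale/= mulrN opprK mulKf ?gt_eqF ?subr_gt0//.
  by rewrite addrAC subrr sub0r.
have cg : {within `[0, b n], continuous g}.
  apply: derivable_within_continuous => x; rewrite in_itv/= => /andP[_ xb].
  by have [] := is_derive1_onem_powR (- a) x (le_lt_trans xb bn1).
have cG : {within `[0, b n], continuous G}.
  apply: derivable_within_continuous => x; rewrite in_itv/= => /andP[_ xb].
  by have [] := dG x (le_lt_trans xb bn1).
rewrite (continuous_FTC2 (F := G) bn0 cg).
- rewrite -EFinB lee_fin /G subr0 powR1 mulr1 opprK gerDr oppr_le0.
  by rewrite mulr_ge0 ?powR_ge0// invr_ge0 subr_ge0 ltW.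
- have /continuous_within_itvP := cG => /(_ bn0)[_ ? ?]; split => //.
  move=> x; rewrite in_itv/= => /andP[_ xb].
  by have [] := dG x (lt_trans xb bn1).
- move=> x; rewrite in_itv/= => /andP[_ xb].
  by have [] := dG x (lt_trans xb bn1); rewrite derive1E.
Qed.

(** * The integral F, its inverse, and the generalized cosine *)

Section Fpq_theory.
Context {R : realType} (p q : R).
Hypotheses (p1 : 1 < p) (q1 : 1 < q).

Let q0 : 0 < q := lt_trans ltr01 q1.
Let pV01 : 0 < p^-1 < 1.
Proof. by rewrite invr_gt0 (lt_trans ltr01)//= invf_lt1// (lt_trans ltr01). Qed.

(** Since 1 < q, t^q <= t on [0, 1], so the integrand is at most (1 - t)^(-1/p), where 0 < 1/p <
    1. *)
Lemma Fpq_integrable : lebesgue_measure.-integrable `[0, 1]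
  (EFin \o (fun t : R => ((1 - t `^ q) `^ p^-1)^-1)).
Proof.
have /andP[pV0 pV1] := pV01.
apply: (le_integrable _ _ _ (integrable_onem_powRN _ pV01)).
- exact: measurable_itv.
- apply/measurable_EFinP.
  apply: (@measurable_funS _ _ _ _ setT) => //.
  rewrite (_ : (fun _ => _) = (fun t : R => (1 - t `^ q) `^ (- p^-1))); last first.
    by apply/funext => t; rewrite powRN.
  apply: (measurableT_comp (measurable_powR _)).
  by apply: measurable_funB => //; exact: measurable_powR.
- move=> t /=; rewrite in_itv/= => /andP[t0 t1].
  rewrite !ger0_norm ?invr_ge0 ?powR_ge0// lee_fin powRN.
  (* At t = 1 both bases are 0, so the two sides coincide. *)
  move: t1; rewrite le_eqVlt => /predU1P[->|t1].
    by rewrite powR1 subrr powR0 ?gt_eqF.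
  have tq : t `^ q <= t.
    move: t0; rewrite le_eqVlt => /predU1P[<-|t0]; first by rewrite powR0 ?gt_eqF.
    by rewrite ge1r_powR// ?t0 ltW.
  rewrite lef_pV2 ?posrE ?powR_gt0 ?subr_gt0 ?(le_lt_trans tq)//.
  rewrite ge0_ler_powR ?nnegrE ?subr_ge0 ?lerB ?(ltW pV0)// ?(ltW t1)//.
  by rewrite (le_trans tq)// ltW.
Qed.

Lemma Fpq_continuous : {within `[0, 1], continuous (Fpq p q)}.
Proof. by apply: parameterized_integral_continuous => //; exact: Fpq_integrable. Qed.

Lemma is_derive_Fpq (x : R) : 0 < x < 1 ->
  is_derive x 1 (Fpq p q) ((1 - x `^ q) `^ p^-1)^-1.
Proof.
move=> x01; have /andP[x0 x1] := x01; have /andP[xq0 xq1] := powR_itv_oo01 q x q0 x01.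
have xq' : 0 < 1 - x `^ q by rewrite subr_gt0.
have := @continuous_FTC1_closed _ (fun t : R => ((1 - t `^ q) `^ p^-1)^-1) 0 x 1
  x1 Fpq_integrable x0.
case.
  apply: differentiable_continuous; apply/derivable1_diffP.
  have dxq : is_derive x 1 (fun t : R => 1 - t `^ q) (0 - q * x `^ (q - 1)).
    by apply: is_deriveB; exact: is_derive1_powR.
  have nz : (1 - x `^ q) `^ p^-1 != 0 by rewrite gt_eqF// powR_gt0.
  by have [] := @is_deriveV _ (fun t => (1 - t `^ q) `^ p^-1) _ _ _ nz
    (is_derive1_powR_comp (fun t => 1 - t `^ q) p^-1 _ _ xq' dxq).
move=> dF F'; split; first exact: dF.
by rewrite -derive1E.
Qed.

Lemma Fpq0 : Fpq p q 0 = 0.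
Proof. by rewrite /Fpq set_itv1 Rintegral_set1. Qed.

Lemma Fpq_lt : {in `[0, 1] &, {homo Fpq p q : x y / x < y}}.
Proof.
apply: gtr0_derive1_lt_cc; last exact: Fpq_continuous.
- by move=> x; rewrite in_itv/= => /is_derive_Fpq[].
- move=> x; rewrite in_itv/= => x01; rewrite derive1E.
  have [_ ->] := is_derive_Fpq x x01.
  have /andP[xq0 xq1] := powR_itv_oo01 q x q0 x01.
  by rewrite invr_gt0 powR_gt0// subr_gt0.
Qed.

Lemma Fpq1_gt0 : 0 < Fpq p q 1.
Proof. by rewrite -Fpq0 Fpq_lt ?in_itv/= ?lexx ?ler01. Qed.

Lemma FpqK : {in `[0, 1]%R, cancel (Fpq p q) (invFpq p q)}.
Proof.
move=> x x01; apply: pinvKV; last by rewrite inE.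
move=> s t; rewrite !inE /= => s01 t01 st.
have [lt_st|lt_ts|//] := ltgtP s t.
- by have := Fpq_lt _ _ s01 t01 lt_st; rewrite st ltxx.
- by have := Fpq_lt _ _ t01 s01 lt_ts; rewrite st ltxx.
Qed.

Lemma Fpq_onto (y : R) : 0 < y < Fpq p q 1 -> exists2 s, 0 < s < 1 & Fpq p q s = y.
Proof.
move=> /andP[y0 y1].
have [|s] := @IVT R (Fpq p q) 0 1 y ler01 Fpq_continuous.
  by rewrite Fpq0 minEle maxEle !(ltW Fpq1_gt0) (ltW y0) (ltW y1).
rewrite in_itv/= => /andP[s0 s1] Fs; exists s => //.
rewrite !lt_neqAle s0 s1 !andbT; apply/andP; split; apply/eqP => E.
  by move: y0; rewrite -Fs -E Fpq0 ltxx.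
by move: y1; rewrite -Fs E ltxx.
Qed.

Lemma is_derive_invFpq (s : R) : 0 < s < 1 ->
  is_derive (Fpq p q s) 1 (invFpq p q) ((1 - s `^ q) `^ p^-1).
Proof.
move=> s01; have := is_derive_Fpq s s01.
set d := (_ `^ p^-1) => dF.
have d0 : d != 0.
  have /andP[xq0 xq1] := powR_itv_oo01 q s q0 s01.
  by rewrite gt_eqF// powR_gt0// subr_gt0.
have nears : \forall t \near s, 0 < t < 1.
  have := near_in_itvoo (a := 0) (b := 1) (x := s).
  rewrite in_itv/= => /(_ s01); apply: filterS => t.
  by rewrite in_itv.
rewrite -[d]invrK; apply: is_derive_inverse dF _; last by rewrite invr_eq0.
- apply: filterS nears => t /andP[t0 t1]; apply: FpqK.
  by rewrite in_itv/= !ltW.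
- apply: filterS nears => t t01.
  apply: differentiable_continuous; apply/derivable1_diffP.
  by have [] := is_derive_Fpq t t01.
Qed.

(** Near F(s), inside ]0, F(1)[, the floor in [sinpq] is 0 and [sinpq] is the inverse of F, so its
    derivative at F(s) is 1/F'(s). *)
Lemma cospq_Fpq (s : R) : 0 < s < 1 ->
  cospq p q (Fpq p q s) = (1 - s `^ q) `^ p^-1.
Proof.
move=> s01; have /andP[s0 s1] := s01; rewrite /cospq derive1E.
have [_ <-] := is_derive_invFpq s s01.
apply: near_eq_derive.
have F01 : Fpq p q s \in `]0, Fpq p q 1[.
  by rewrite in_itv/= -{1}Fpq0 !Fpq_lt// in_itv/= ?lexx ?ler01 ?(ltW s0) ?(ltW s1).
apply: filterS (near_in_itvoo F01) => y; rewrite in_itv/= => /andP[y0 y1].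
rewrite /sinpq.
have -> : Num.floor (y / pipq p q) = 0.
  have a0 := Fpq1_gt0.
  apply/eqP; rewrite floor_eq add0r mulr0z mulr1z /pipq.
  rewrite divr_ge0 ?mulr_ge0 ?(ltW a0) ?(ltW y0)//=.
  by rewrite ltr_pdivrMr ?mul1r ?mulr_gt0//; lra.
rewrite mul0r subr0 expr0z mul1r /sinpq0.
by rewrite ifT// /pipq mulrC mulKf// ltW.
Qed.

End Fpq_theory.

(** * Continuity and mean value tools *)

(** Serves to compose [Fpq], whose continuity is known within [0, 1], with a substitution taking
    values there. *)
Lemma within_continuous_comp {T U V : topologicalType} (A : set T) (B : set U)
    (f : U -> V) (g : T -> U) :
  {within B, continuous f} -> {within A, continuous g} ->
  {homo g : x / A x >-> B x} -> {within A, continuous (f \o g)}.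
Proof.
move=> /subspace_continuousP fB /subspace_continuousP gA gAB.
apply/subspace_continuousP => x Ax; apply: cvg_comp (fB _ (gAB _ Ax)).
move=> P /= BP; have := gA _ Ax _ BP; rewrite /= !near_simpl.
by rewrite !near_withinE; apply: filterS => t /= BPt At; exact: BPt (gAB _ At).
Qed.

(** At 0 the bound |y| < e^(1/a) gives |y|^a < e; elsewhere the power is differentiable at |x| >
    0. *)
Lemma continuous_norm_powR {R : realType} (a : R) : 0 < a ->
  continuous (fun x : R => `|x| `^ a).
Proof.
move=> a0 x; have [->|x0] := eqVneq x 0.
  rewrite /continuous_at normr0 powR0 ?gt_eqF//.
  apply/cvgr0Pnorm_lt => e e0.
  have e'0 : 0 < e `^ a^-1 by exact: powR_gt0.
  near=> y; rewrite ger0_norm ?powR_ge0//.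
  have -> : e = (e `^ a^-1) `^ a.
    by rewrite -powRrM mulVf ?gt_eqF// powRr1// ltW.
  rewrite gt0_ltr_powR ?nnegrE ?powR_ge0//.
have dP : {for `|x|, continuous (fun y : R => y `^ a)}.
  apply: differentiable_continuous; apply/derivable1_diffP.
  by have [] := @is_derive1_powR _ a `|x| _; rewrite ?normr_gt0.
exact: (@continuous_comp R R R (fun y : R => `|y|) _ x (@norm_continuous _ R x) dP).
Unshelve. all: by end_near. Qed.

Lemma derive_within_continuous_MVT {R : realType} (f df : R -> R) (a b : R) : a < b ->
  (forall x, a < x < b -> is_derive x 1 f (df x)) ->
  {within `[a, b], continuous f} ->
  exists2 c, a < c < b & f b - f a = df c * (b - a).
Proof.
move=> ab dF cf.
have dF' x : x \in `]a, b[ -> is_derive x 1 f (df x) by rewrite in_itv => /dF.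
by have [c] := MVT ab dF' cf; rewrite in_itv; exists c.
Qed.

(** * The case of the ordinary cosine *)

(** Strict convexity of tan on [0, pi/4], with chord from (0, 0) to (pi/4, 1): the mean slopes on
    the two sides of x are values of 1/cos^2 at [y1] < [y2]. *)
Lemma tan_lt_chord {R : realType} (x : R) : 0 < x < pi / 4 -> tan x < 4 / pi * x.
Proof.
move=> /andP[x0 x1]; have p0 := @pi_gt0 R.
have cos0 (y : R) : 0 <= y <= pi / 4 -> 0 < cos y.
  by move=> /andP[y0 y1]; apply: cos_gt0_pihalf; lra.
have dtan (y : R) : 0 <= y <= pi / 4 -> is_derive y 1 tan ((cos y) ^- 2).
  by move=> y01; apply: is_derive_tan; rewrite gt_eqF// cos0.
have ctan (u v : R) : 0 <= u -> v <= pi / 4 -> {within `[u, v], continuous (@tan R)}.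
  move=> u0 v1; apply: derivable_within_continuous => y; rewrite in_itv/= => /andP[uy yv].
  have y01 : 0 <= y <= pi / 4 by lra.
  by have [] := dtan y y01.
have mvt (u v : R) : 0 <= u -> v <= pi / 4 -> u < v ->
    exists2 c, u < c < v & tan v - tan u = (cos c) ^- 2 * (v - u).
  move=> u0 v1 uv; apply: (derive_within_continuous_MVT tan) => //.
    by move=> y uyv; apply: dtan; lra.
  exact: ctan.
have [y1 y1x e1] := mvt 0 x (lexx _) (ltW x1) x0.
have [y2 y2x e2] := mvt x (pi / 4) (ltW x0) (lexx _) x1.
move: e1 e2; rewrite tan_piquarter tan0 !subr0 => e1 e2.
have lt12 : (cos y1) ^- 2 < (cos y2) ^- 2.
  have c1 : 0 < cos y1 by apply: cos0; lra.
  have c2 : 0 < cos y2 by apply: cos0; lra.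
  rewrite ltf_pV2 ?posrE ?exprn_gt0// ltr_sqr ?nnegrE ?(ltW c1) ?(ltW c2)//.
  by rewrite ltr_cos ?in_itv/=; lra.
set d1 := (cos y1) ^- 2 in e1 lt12; set d2 := (cos y2) ^- 2 in e2 lt12.
rewrite mulrAC ltr_pdivlMr// -subr_gt0.
(* Cross-multiplied comparison of the slopes tan x / x and (1 - tan x)/(pi/4 - x). *)
have -> : 4 * x - tan x * pi = 4 * (x * (1 - tan x) - tan x * (pi / 4 - x)).
  by field.
rewrite e2 e1.
have -> : 4 * (x * (d2 * (pi / 4 - x)) - d1 * x * (pi / 4 - x)) =
  4 * ((d2 - d1) * (x * (pi / 4 - x))) by ring.
by rewrite !mulr_gt0// subr_gt0.
Qed.

(** The left-hand side decreases in y/a and equals cos theta when y/a = tan(theta/2); [tan_lt_chord]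
    at theta/2 and the chord bound give a tan(theta/2) < y. *)
Lemma redheffer_cos_of_chord {R : realType} (a y theta : R) : 0 < theta < pi / 2 -> 0 < a ->
  a * (2 / pi * theta) <= y ->
  (a ^+ 2 - y ^+ 2) / (a ^+ 2 + y ^+ 2) < cos theta.
Proof.
move=> /andP[t0 t1] a0 ay; have p0 := @pi_gt0 R.
have h4 : 0 < theta / 2 < pi / 4 by lra.
have Tlt := tan_lt_chord _ h4.
have c0 : 0 < cos (theta / 2) by apply: cos_gt0_pihalf; lra.
have T0 : 0 < tan (theta / 2).
  by rewrite divr_gt0// sin_gt0_pihalf//; lra.
have cT : cos (theta / 2) ^+ 2 * (1 + tan (theta / 2) ^+ 2) = 1.
  by rewrite -cos2_tan2 ?gt_eqF// mulfV// gt_eqF// exprn_gt0.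
have -> : cos theta = 2 * cos (theta / 2) ^+ 2 - 1.
  by rewrite {1}[theta]splitr cosD -!expr2 sin2cos2; ring.
have aTy : a * tan (theta / 2) < y.
  apply: lt_le_trans ay; rewrite ltr_pM2l//; apply: (lt_le_trans Tlt).
  lra.
have C0 : 0 < cos (theta / 2) ^+ 2 by rewrite exprn_gt0.
have sq : (a * tan (theta / 2)) ^+ 2 < y ^+ 2.
  have aT0 : 0 < a * tan (theta / 2) by exact: mulr_gt0.
  by rewrite ltr_pXn2r ?nnegrE ?(ltW aT0) ?(ltW (lt_trans aT0 aTy)).
rewrite ltr_pdivrMr ?ltr_wpDr ?sqr_ge0 ?exprn_gt0//.
move: cT sq C0; rewrite (exprMn 2 a (tan (theta / 2))).
set C := cos _ ^+ 2; set T := tan _ ^+ 2; set A := a ^+ 2; set Y := y ^+ 2 => cT sq C0.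
have : C * (A * T) < C * Y by rewrite ltr_pM2l.
(* With cos theta = 2C - 1, the goal reduces to A (1 - C) < C Y. *)
have -> : C * (A * T) = A * (1 - C) by rewrite -{1}cT; ring.
lra.
Qed.

(** * Quasi-monotonicity of the logarithm of the density *)

(* The hypothesis forces [1 < m], and then the slopes of the chords of
   [t `^ m] issued from 1 increase. *)
Lemma powR_chord_compare {R : realType} (m b x y : R) : 0 < m -> 2^-1 <= b -> 1 < x < y ->
  2 * b * m * (x - 1) < x `^ m - 1 -> 2 * b * m * (y - 1) < y `^ m - 1.
Proof.
move=> m0 b2 /andP[x1 xy] Hx.
have mvt (u v : R) : 1 <= u -> u < v ->
    exists2 c, u < c < v & v `^ m - u `^ m = m * c `^ (m - 1) * (v - u).
  move=> u1 uv; apply: (derive_within_continuous_MVT (fun t : R => t `^ m)) => //.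
    by move=> c /andP[uc _]; apply: is_derive1_powR; apply: lt_trans uc; lra.
  apply: derivable_within_continuous => c; rewrite in_itv/= => /andP[uc _].
  by have [] := @is_derive1_powR _ m c (lt_le_trans ltr01 (le_trans u1 uc)).
have [c /andP[c1 cx]] := mvt 1 x (lexx _) x1.
rewrite powR1 => ec.
have [d /andP[xd dy] ed] := mvt x y (ltW x1) xy.
have c2b : 2 * b < c `^ (m - 1).
  move: Hx; rewrite ec ltr_pM2r ?subr_gt0// [2 * b * m]mulrC ltr_pM2l//.
have m1 : 0 <= m - 1.
  rewrite leNgt; apply/negP => m1.
  have : c `^ (m - 1) <= c `^ 0 by rewrite ler_powR// ltW.
  rewrite powRr0; lra.
have cd : c `^ (m - 1) <= d `^ (m - 1).
  by rewrite ge0_ler_powR// ?nnegrE; lra.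
have : m * (2 * b) * (y - x) < m * d `^ (m - 1) * (y - x).
  by rewrite ltr_pM2r ?subr_gt0// ltr_pM2l//; lra.
rewrite -ed; lra.
Qed.

(** The logarithm of the density k in the variable x = cos^2 t, with m = r/2. The absolute value
    gives continuity at x = 0. *)
Definition ln_ratio {R : realType} (m b x : R) : R :=
  ln (1 - x) / 2 - b * ln (1 - `|x| `^ m).

Section ratio.
Context {R : realType} (m b : R).
Hypotheses (m0 : 0 < m) (b2 : 2^-1 <= b).

Local Notation N := (ln_ratio m b).
(** [E] carries the sign of the derivative [dN] on ]0, 1[; [E w < 0] is the hypothesis of
    [powR_chord_compare] at 1/w. *)
Let E (w : R) := 2 * b * m * (w^-1 - 1) - (w^-1 `^ m - 1).
Let dN (w : R) := w `^ m / (2 * (1 - w) * (1 - w `^ m)) * E w.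

Let powm_lt1 (w : R) : 0 <= w < 1 -> 0 <= w `^ m < 1.
Proof.
move=> /andP[w0 w1]; rewrite powR_ge0/=.
have : w `^ m < 1 `^ m by rewrite gt0_ltr_powR ?nnegrE ?ler01.
by rewrite powR1.
Qed.

Let is_derive_N (w : R) : 0 < w < 1 -> is_derive w 1 N (dN w).
Proof.
move=> /andP[w0 w1].
have /andP[P0 P1] : 0 <= w `^ m < 1 by rewrite powm_lt1// w1 ltW.
have Pp : 0 < w `^ m by rewrite powR_gt0.
have d1 : is_derive w 1 (fun x : R => 1 - x) (0 - 1) by exact: is_deriveB.
have d2 : is_derive w 1 (fun x : R => 1 - x `^ m) (0 - m * w `^ (m - 1)).
  by apply: is_deriveB; exact: is_derive1_powR.
have l1 := @is_derive1_comp _ (@ln R) _ w _ _ (is_derive1_ln _) d1.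
have l2 := @is_derive1_comp _ (@ln R) _ w _ _ (is_derive1_ln _) d2.
have dd := is_deriveB (is_deriveZ 2^-1 (l1 _)) (is_deriveZ b (l2 _)).
apply: (near_eq_is_derive (f := fun x : R => 2^-1 * ln (1 - x) - b * ln (1 - x `^ m))).
  near=> x; rewrite /ln_ratio ger0_norm; first by rewrite mulrC.
  by apply/ltW; near: x; exact: lt_nbhsr.
apply: is_derive_eq.
  by apply: dd; rewrite subr_gt0.
rewrite /dN /E /GRing.scale/= powRB; last by rewrite (gt_eqF w0) implybT.
have -> : w^-1 `^ m = (w `^ m)^-1.
  by rewrite -(powR_inv1 (ltW w0)) -powRrM mulN1r powRN.
rewrite powRr1 ?ltW//.
have w1' : 1 - w != 0 by rewrite gt_eqF ?subr_gt0.
have P1' : 1 - w `^ m != 0 by rewrite gt_eqF ?subr_gt0.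
field; by rewrite w1' P1' !gt_eqF.
Unshelve. all: by end_near. Qed.

Let continuous_N (u v : R) : 0 <= u -> v < 1 -> {within `[u, v], continuous N}.
Proof.
move=> u0 v1; apply: continuous_in_subspaceT => x; rewrite inE/= in_itv/= => /andP[ux xv].
have x0 := le_trans u0 ux; have x1 := le_lt_trans xv v1.
have /andP[P0 P1] : 0 <= x `^ m < 1 by rewrite powm_lt1// x0.
have c2 : {for x, continuous (fun x : R => 1 - `|x| `^ m)}.
  by apply: continuousB; [exact: cst_continuous|exact: continuous_norm_powR].
have c1 : {for x, continuous (fun x : R => 1 - x)}.
  by apply: continuousB; [exact: cst_continuous|exact: cvg_id].
have l1 : {for x, continuous (fun x : R => ln (1 - x))}.
  by apply: (@continuous_comp R R R _ _ x c1); apply: continuous_ln; rewrite subr_gt0.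
have l2 : {for x, continuous (fun x : R => ln (1 - `|x| `^ m))}.
  apply: (@continuous_comp R R R _ _ x c2); apply: continuous_ln.
  by rewrite ger0_norm// subr_gt0.
have n1 : {for x, continuous (fun x : R => ln (1 - x) / 2)}.
  by apply: continuousM => //; exact: cst_continuous.
have n2 : {for x, continuous (fun x : R => b * ln (1 - `|x| `^ m))}.
  by apply: continuousM => //; exact: cst_continuous.
exact: (@continuousB _ _ _ _ _ x n1 n2).
Qed.

(** A drop from x to y gives w in ]x, y[ with N' < 0, while the rise from N(0) = 0 to N(x) > 0 gives
    v in ]0, x[ with N' >= 0. But 1/w < 1/v, so [powR_chord_compare] carries the negative sign from
    w to v. *)
Lemma ln_ratio_quasi (x y : R) : 0 < x < y -> y < 1 -> 0 < N x -> N x <= N y.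
Proof.
move=> /andP[x0 xy] y1 Nx0; rewrite leNgt; apply/negP => Nyx.
have dNs (w : R) : 0 < w < 1 -> (dN w < 0) = (E w < 0).
  move=> /andP[w0 w1].
  have /andP[P0 P1] : 0 <= w `^ m < 1 by rewrite powm_lt1// w1 ltW.
  rewrite pmulr_rlt0// divr_gt0 ?powR_gt0// !mulr_gt0 ?subr_gt0//.
have mvt (u v : R) : 0 <= u -> u < v -> v < 1 ->
    exists2 c, u < c < v & N v - N u = dN c * (v - u).
  move=> u0 uv v1; apply: derive_within_continuous_MVT => //; last exact: continuous_N.
  by move=> c /andP[uc cv]; apply: is_derive_N; rewrite (le_lt_trans u0 uc) (lt_trans cv v1).
have [w /andP[xw wy] ew] := mvt x y (ltW x0) xy y1.
have [v /andP[v0 vx] ev] := mvt 0 x (lexx _) x0 (lt_trans xy y1).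
have N0 : N 0 = 0 by rewrite /ln_ratio subr0 normr0 powR0 ?gt_eqF// subr0 ln1 mul0r mulr0 subr0.
have w01 : 0 < w < 1 by rewrite (lt_trans x0 xw) (lt_trans wy y1).
have v01 : 0 < v < 1 by rewrite v0 (lt_trans vx (lt_trans xy y1)).
have dw : dN w < 0 by rewrite -(pmulr_llt0 _ (_ : 0 < y - x)) -?ew ?subr_lt0 ?subr_gt0.
have dv : ~~ (dN v < 0).
  rewrite -leNgt -(pmulr_lge0 _ (_ : 0 < x - 0)) -?ev ?subr0// N0 subr0 ltW//.
apply/negP: dv; rewrite negbK dNs//; move: dw; rewrite dNs// /E !subr_lt0.
have /andP[w0 w1] := w01.
by apply: powR_chord_compare; rewrite // invf_gt1// w1 ltf_pV2 ?posrE// (lt_trans vx).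
Qed.
End ratio.

(** * The density in the angle variable and the substitution for s *)

Definition arc_density {R : realType} (r b theta : R) : R :=
  (1 - cos theta `^ r) `^ (- b) * sin theta.

Section arc_density.
Context {R : realType} (r b : R).
Hypotheses (r0 : 0 < r) (b2 : 2^-1 <= b).

Local Notation k := (arc_density r b).

Lemma cos_powR_itv (t : R) : 0 < t < pi / 2 -> 0 < cos t `^ r < 1.
Proof.
move=> /andP[t0 t1]; have p0 := @pi_gt0 R.
have c0 : 0 < cos t by apply: cos_gt0_pihalf; lra.
have c1 : cos t < 1 by rewrite -[ltRHS](@cos0 R) ltr_cos ?in_itv/=; lra.
by apply: powR_itv_oo01; rewrite ?c0.
Qed.

Lemma arc_density_gt0 (t : R) : 0 < t < pi / 2 -> 0 < k t.
Proof.
move=> t01; have /andP[P0 P1] := cos_powR_itv _ t01.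
by rewrite mulr_gt0 ?powR_gt0 ?subr_gt0// sin_gt0_pihalf.
Qed.

Lemma ln_arc_density (t : R) : 0 < t < pi / 2 ->
  ln (k t) = ln_ratio (r / 2) b (cos t ^+ 2).
Proof.
move=> t01; have /andP[t0 t1] := t01.
have /andP[P0 P1] := cos_powR_itv _ t01.
have s0 : 0 < sin t by exact: sin_gt0_pihalf.
have c0 : 0 < cos t by apply: cos_gt0_pihalf; lra.
rewrite lnM ?posrE ?powR_gt0 ?subr_gt0// ln_powR /ln_ratio -sin2cos2.
rewrite ger0_norm ?sqr_ge0// -(powR_mulrn 2 (ltW c0)) -powRrM.
have -> : 2%:R * (r / 2) = r by field.
rewrite -(powR_mulrn 2 (ltW s0)) ln_powR; lra.
Qed.

(** Since cos^2 reverses order, this is [ln_ratio_quasi] from cos^2 u to cos^2 t; 1 < k(u) becomes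
    positivity of the logarithm. *)
Lemma arc_density_quasi (t u : R) : 0 < t < u -> u < pi / 2 -> 1 < k u -> k u <= k t.
Proof.
move=> /andP[t0 tu] u1 k1; have p0 := @pi_gt0 R.
have t01 : 0 < t < pi / 2 by lra.
have u01 : 0 < u < pi / 2 by lra.
have ku0 := arc_density_gt0 _ u01; have kt0 := arc_density_gt0 _ t01.
rewrite -ler_ln ?posrE// !ln_arc_density//.
have ct : 0 < cos t by apply: cos_gt0_pihalf; lra.
have cu : 0 < cos u by apply: cos_gt0_pihalf; lra.
have cut : cos u < cos t by rewrite ltr_cos ?in_itv/=; lra.
have c1 : cos t < 1 by rewrite -[ltRHS](@cos0 R) ltr_cos ?in_itv/=; lra.
apply: ln_ratio_quasi => //.
- by rewrite divr_gt0.
- by rewrite exprn_gt0//= ltr_pXn2r// nnegrE ltW.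
- by rewrite expr_lt1// ltW.
- by rewrite -ln_arc_density// ln_gt0.
Qed.

End arc_density.

(* The absolute values change nothing on [0, pi / 2]; they make the function
   continuous everywhere, since [x `^ a] is 1 for [x < 0]. *)
Definition cos_conj {R : realType} (r e t : R) : R :=
  `|1 - `|cos t| `^ r| `^ e.

Section cos_conj.
Context {R : realType} (r e : R).
Hypotheses (r0 : 0 < r) (e0 : 0 < e).

Lemma cos_conjE (t : R) : 0 < t < pi / 2 -> cos_conj r e t = (1 - cos t `^ r) `^ e.
Proof.
move=> t01; have /andP[_ P1] := cos_powR_itv r r0 t t01.
have c0 : 0 < cos t by apply: cos_gt0_pihalf; lra.
by rewrite /cos_conj (ger0_norm (ltW c0)) ger0_norm// subr_ge0 ltW.
Qed.

Lemma cos_conj0 : cos_conj r e 0 = 0.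
Proof. by rewrite /cos_conj cos0 normr1 powR1 subrr normr0 powR0// gt_eqF. Qed.

Lemma cos_conj_pihalf : cos_conj r e (pi / 2) = 1.
Proof.
by rewrite /cos_conj cos_pihalf normr0 powR0 ?gt_eqF// subr0 normr1 powR1.
Qed.

Lemma continuous_cos_conj : continuous (cos_conj r e).
Proof.
move=> t; have c1 : {for t, continuous (fun t : R => `|cos t| `^ r)}.
  exact: (@continuous_comp R R R _ (fun x => `|x| `^ r) t (@continuous_cos R t)
    (continuous_norm_powR r r0 _)).
have c2 : {for t, continuous (fun t : R => 1 - `|cos t| `^ r)}.
  by apply: continuousB => //; exact: cst_continuous.
exact: (@continuous_comp R R R _ (fun x => `|x| `^ e) t c2
    (continuous_norm_powR e e0 _)).
Qed.

Lemma is_derive_cos_conj (t : R) : 0 < t < pi / 2 -> is_derive t 1 (cos_conj r e)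
  (e * (1 - cos t `^ r) `^ (e - 1) * (r * (cos t `^ (r - 1) * sin t))).
Proof.
move=> t01; have c0 : 0 < cos t by apply: cos_gt0_pihalf; lra.
have /andP[P0 P1] := cos_powR_itv r r0 t t01.
have d1 := is_derive1_powR_comp (@cos R) r t _ c0 (is_derive_cos t).
have d2 : is_derive t 1 (fun t : R => 1 - cos t `^ r)
    (0 - r * cos t `^ (r - 1) * - sin t) by exact: is_deriveB.
have P1' : 0 < 1 - cos t `^ r by rewrite subr_gt0.
have d3 := is_derive1_powR_comp (fun t : R => 1 - cos t `^ r) e t _ P1' d2.
apply: (near_eq_is_derive (f := fun t : R => (1 - cos t `^ r) `^ e)).
  near=> u; rewrite cos_conjE//.
  suff : u \in `]0, pi / 2[ by rewrite in_itv.
  by near: u; apply: near_in_itvoo; rewrite in_itv.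
by apply: is_derive_eq d3 _; ring.
Unshelve. all: by end_near. Qed.

End cos_conj.

(** * An antiderivative of the density lies above its chord *)

Section chord.
Context {R : realType} (r b : R) (Z : R -> R).
(** In the application b = 1 - 1/q and [Z] is (q/r) F(s(t)); then [b2] says 2 <= q, and [br] says r
    <= q, that is, p >= q/(q - 1). *)
Hypotheses (r1 : 1 < r) (b2 : 2^-1 <= b) (br : 1 - r^-1 <= b).
Hypotheses (cZ : {within `[0, pi / 2], continuous Z}) (Z0 : Z 0 = 0).
Hypothesis dZ : forall t, 0 < t < pi / 2 -> is_derive t 1 Z (arc_density r b t).

Let p0 : 0 < pi / 2 :> R. Proof. by rewrite divr_gt0// pi_gt0. Qed.
Let r0 : 0 < r := lt_trans ltr01 r1.

Let rV0 : 0 < r^-1. Proof. by rewrite invr_gt0. Qed.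

(** For t in [0, pi/2] the point (cos t, y t) runs along the curve x^r + y^r = 1. *)
Local Notation y := (cos_conj r r^-1).

Let pos (t : R) : 0 < t < pi / 2 -> [/\ 0 < cos t, cos t <= 1, 0 < sin t & sin t <= 1].
Proof.
move=> t01; split; rewrite ?cos_le1 ?sin_le1 ?sin_gt0_pihalf//.
by apply: cos_gt0_pihalf; lra.
Qed.

Let mean_value_ge0 (f df : R -> R) : {within `[0, pi / 2], continuous f} ->
  (forall t, 0 < t < pi / 2 -> is_derive t 1 f (df t)) ->
  (forall t, 0 < t < pi / 2 -> 0 <= df t) -> f 0 <= f (pi / 2).
Proof.
move=> cf dF df0; have [c c01] := derive_within_continuous_MVT f df 0 (pi / 2) p0 dF cf.
by rewrite -subr_ge0 subr0 => ->; rewrite mulr_ge0 ?df0// ltW.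
Qed.

(* For [r <= 2] the density is at least 1.  For [2 <= r] and [b = 1 - 1/r],
   [Z (pi / 2)] is twice the area of the quarter disc [x^r + y^r <= 1], which
   contains the Euclidean one; [M] is the resulting antiderivative. *)
Lemma total_arc_ge_pihalf : pi / 2 <= Z (pi / 2).
Proof.
have cZid : {within `[0, pi / 2], continuous (fun t => Z t - t)}.
  have cid : {within `[0, pi / 2], continuous (fun t : R => t)}.
    by apply: continuous_subspaceT => t; exact: cvg_id.
  by move=> t; exact: (@continuousB _ _ _ _ _ t (cZ t) (cid t)).
have [r2|/ltW r2] := leP r 2.
  rewrite -subr_ge0 -[leLHS](_ : Z 0 - 0 = 0); last by rewrite Z0 subr0.
  apply: (mean_value_ge0 (fun t => Z t - t) (fun t => arc_density r b t - 1)).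
  - exact: cZid.
  - by move=> t t01; apply: is_deriveB; exact: dZ.
  move=> t t01; rewrite subr_ge0 /arc_density powRN mulrC.
  have [c0 c1 s0 s1] := pos t t01; have /andP[P0 P1] := cos_powR_itv r r0 t t01.
  rewrite ler_pdivlMr ?powR_gt0 ?subr_gt0// mul1r.
  (* As 1/2 <= b and r <= 2, (1 - cos^r t)^b <= (1 - cos^r t)^(1/2) <= (1 - cos^2 t)^(1/2) = sin
     t. *)
  apply: (@le_trans _ _ ((1 - cos t `^ r) `^ 2^-1)).
    by rewrite ger_powR// subr_gt0 P1 gerDl oppr_le0 ltW.
  rewrite -[leRHS]ger0_norm ?(ltW s0)// -sqrtr_sqr -powR12_sqrt ?sqr_ge0//.
  rewrite ge0_ler_powR ?nnegrE ?sqr_ge0 ?subr_ge0 ?(ltW P1) ?invr_ge0//.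
  by rewrite sin2cos2 lerB// -powR_mulrn ?(ltW c0)// ger_powR// c0.
(* The correction term vanishes at both ends. If b = 1 - 1/r, the powers in [dM] cancel and 2 sin t
   (y - sin t) remains, twice the area element between the two curves; a larger b only increases
   [dM], as 0 < 1 - cos^r t < 1. *)
pose M t := Z t - t - cos t * (y t - sin t).
pose dM t := sin t * ((1 - cos t `^ r) `^ (- b) - (1 - cos t `^ r) `^ (r^-1 - 1)
  + 2 * (y t - sin t)).
have M0 : M 0 = 0.
  by rewrite /M Z0 (cos_conj0 r _ rV0) sin0 !subrr mulr0 subrr.
have M1 : M (pi / 2) = Z (pi / 2) - pi / 2 by rewrite /M cos_pihalf mul0r subr0.
rewrite -subr_ge0 -M1 -M0.
apply: (mean_value_ge0 M dM).
- have cY : {within `[0, pi / 2], continuous (fun t => cos t * (y t - sin t))}.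
    apply: continuous_subspaceT => t.
    have cys := @continuousB _ _ _ _ _ t (continuous_cos_conj r r^-1 r0 rV0 t) (@continuous_sin R t).
    exact: (@continuousM _ _ _ _ t (@continuous_cos R t) cys).
  by move=> t; exact: (@continuousB _ _ _ _ _ t (cZid t) (cY t)).
- move=> t t01; have [c0 c1 s0 s1] := pos t t01.
  have /andP[P0 P1] := cos_powR_itv r r0 t t01.
  have dcy := is_deriveM (is_derive_cos t) 
    (is_deriveB (is_derive_cos_conj r r^-1 r0 t t01) (is_derive_sin t)).
  apply: is_derive_eq (is_deriveB (is_deriveB (dZ t t01) (is_derive_id t 1)) dcy) _.
  rewrite /dM /arc_density /GRing.scale/=.
  have Py : (1 - cos t `^ r) `^ (r^-1 - 1) * (1 - cos t `^ r) = y t.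
    by rewrite cos_conjE// mulrC mulr_powRB1 ?invr_gt0// subr_ge0 ltW.
  have cc : cos t * cos t `^ (r - 1) = cos t `^ r by rewrite mulr_powRB1// ltW.
  have cs := cos2Dsin2 t.
  move: Py cc cs.
  set A := _ `^ (r^-1 - 1); set B := cos t `^ (r - 1); set K := _ `^ (- b).
  set C := cos t `^ r => Py cc cs.
  have -> : cos t * (r^-1 * A * (r * (B * sin t)) - cos t) =
      A * (cos t * B) * sin t - cos t ^+ 2 by field; rewrite gt_eqF.
  have -> : A * (cos t * B) = A - y t by rewrite cc -Py; ring.
  have -> : cos t ^+ 2 = 1 - sin t ^+ 2 by rewrite -cs addrK.
  rewrite -[(y - sin) t]/(y t - sin t); ring.
- move=> t t01; have [c0 c1 s0 s1] := pos t t01.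
  have /andP[P0 P1] := cos_powR_itv r r0 t t01.
  rewrite mulr_ge0 ?(ltW s0)// addr_ge0//.
    rewrite subr_ge0 ger_powR//; last by rewrite lerNl opprB.
    by rewrite subr_gt0 P1 gerDl oppr_le0 ltW.
  rewrite mulr_ge0// subr_ge0 cos_conjE//.
  (* For 2 <= r, sin^r t + cos^r t <= sin^2 t + cos^2 t = 1, so the circle lies below the curve of
     [y]. *)
  have -> : sin t = (sin t `^ r) `^ r^-1.
    by rewrite -powRrM (mulfV (lt0r_neq0 r0)) powRr1// ltW.
  rewrite ge0_ler_powR ?nnegrE ?powR_ge0 ?invr_ge0 ?subr_ge0 ?(ltW r0) ?(ltW P1)//.
  rewrite lerBrDr -(cos2Dsin2 t) addrC lerD//.
    by rewrite -powR_mulrn ?(ltW c0)// ger_powR// c0.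
  by rewrite -powR_mulrn ?(ltW s0)// ger_powR// s0.
Qed.

Lemma arc_ge_chord (t : R) : 0 < t < pi / 2 -> Z (pi / 2) * (2 / pi * t) <= Z t.
Proof.
move=> /andP[t0 t1]; have pi0 := @pi_gt0 R.
set kp := Z (pi / 2) * (2 / pi).
(* The mean slope is at least 1, so kp < k(v) yields the condition 1 < k(v) of [arc_density_quasi],
   whence k(v) <= k(u) < kp < k(v). *)
have kp1 : 1 <= kp.
  have := total_arc_ge_pihalf; rewrite /kp -ler_pdivrMr ?divr_gt0//.
  by apply: le_trans; rewrite mul1r invf_div.
rewrite mulrA -/kp leNgt; apply/negP => Zt.
have mvt (u v : R) : 0 <= u -> u < v -> v <= pi / 2 ->
    exists2 c, u < c < v & Z v - Z u = arc_density r b c * (v - u).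
  move=> u0 uv v1; apply: derive_within_continuous_MVT => //.
    by move=> c /andP[uc cv]; apply: dZ; rewrite (le_lt_trans u0 uc) (lt_le_trans cv v1).
  by apply: continuous_subspaceW cZ; apply: subset_itv; rewrite bnd_simp.
have [u /andP[u0 ut]] := mvt 0 t (lexx _) t0 (ltW t1).
rewrite Z0 !subr0 => eu.
have [v /andP[tv v1] ev] := mvt t (pi / 2) (ltW t0) t1 (lexx _).
have ku : arc_density r b u < kp by rewrite -(ltr_pM2r t0) -eu.
have kv : kp < arc_density r b v.
  rewrite -(ltr_pM2r (_ : 0 < pi / 2 - t)) ?subr_gt0// -ev mulrBr.
  have -> : kp * (pi / 2) = Z (pi / 2) by rewrite /kp -mulrA -[2 / pi]invf_div mulVf ?mulr1// gt_eqF.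
  by rewrite ltrD2l ltrN2.
have := arc_density_quasi r b r0 b2 u v _ v1 (le_lt_trans kp1 kv).
by rewrite u0 (lt_trans ut tv) => /(_ isT); lra.
Qed.
End chord.

(** * Application to the generalized cosine *)

Section redheffer.
Context {R : realType} (p q : R).
Hypotheses (q2 : 2 <= q) (pq : q / (q - 1) <= p).

Let q1 : 1 < q. Proof. by apply: lt_le_trans q2; rewrite ltr1n. Qed.

Let p1 : 1 < p.
Proof. by apply: lt_le_trans pq; rewrite ltr_pdivlMr ?mul1r ?gtrBl ?subr_gt0. Qed.

Let q0 : 0 < q := lt_trans ltr01 q1.
Let p0 : 0 < p := lt_trans ltr01 p1.

Let r : R := p / (p - 1).

Let pB0 : 0 < p - 1. Proof. by rewrite subr_gt0. Qed.

Let r1 : 1 < r. Proof. by rewrite ltr_pdivlMr ?mul1r ?gtrBl. Qed.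
Let r0 : 0 < r := lt_trans ltr01 r1.

Let rVE : r^-1 = 1 - p^-1.
Proof. by rewrite invf_div mulrBl mulfV ?gt_eqF// mul1r. Qed.

Let Z (t : R) := q / r * Fpq p q (cos_conj r q^-1 t).

Let Z_continuous : {within `[0, pi / 2], continuous Z}.
Proof.
have qV0 : 0 < q^-1 by rewrite invr_gt0.
have cF : {within `[0, pi / 2], continuous (Fpq p q \o cos_conj r q^-1)}.
  apply: within_continuous_comp (Fpq_continuous p q p1 q1) _ _.
    exact: continuous_subspaceT (continuous_cos_conj r q^-1 r0 qV0).
  move=> t /=; rewrite !in_itv/= => /andP[t0 t1].
  rewrite powR_ge0/= /cos_conj.
  have c0 : 0 <= cos t by apply: cos_ge0_pihalf; lra.
  have P1 : cos t `^ r <= 1.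
    have : cos t `^ r <= 1 `^ r.
      by rewrite ge0_ler_powR ?nnegrE ?(ltW r0) ?ler01 ?cos_le1.
    by rewrite powR1.
  rewrite (ger0_norm c0) ger0_norm ?subr_ge0//.
  have : (1 - cos t `^ r) `^ q^-1 <= 1 `^ q^-1.
    by rewrite ge0_ler_powR ?nnegrE ?(ltW qV0) ?ler01 ?subr_ge0// gerBl powR_ge0.
  by rewrite powR1.
move=> t; apply: (@continuousM _ _ (fun=> q / r) _ t _ (cF t)).
exact: cst_continuous.
Qed.

(** With s^q = 1 - cos^r t and r/p = r - 1, F'(s) = 1/cos^(r-1) t cancels the factor cos^(r-1) t of
    s', and q/r cancels the remaining constant. *)
Let is_derive_Z (t : R) : 0 < t < pi / 2 ->
  is_derive t 1 Z (arc_density r (1 - q^-1) t).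
Proof.
move=> t01; have /andP[P0 P1] := cos_powR_itv r r0 t t01.
have c0 : 0 < cos t by apply: cos_gt0_pihalf; lra.
have P1' : 0 < 1 - cos t `^ r by rewrite subr_gt0.
have sq : cos_conj r q^-1 t `^ q = 1 - cos t `^ r.
  by rewrite cos_conjE// -powRrM mulVf ?gt_eqF// powRr1// ltW.
have s01 : 0 < cos_conj r q^-1 t < 1.
  rewrite cos_conjE//; apply: powR_itv_oo01; first by rewrite invr_gt0.
  by rewrite P1'/= gtrBl.
have dF := is_derive_Fpq p q p1 q1 _ s01.
have dZ := is_deriveZ (q / r) (is_derive1_comp dF (is_derive_cos_conj r q^-1 r0 t t01)).
apply: is_derive_eq dZ _; rewrite sq.
have -> : 1 - (1 - cos t `^ r) = cos t `^ r by ring.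
have -> : (cos t `^ r) `^ p^-1 = cos t `^ (r - 1).
  by rewrite -powRrM; congr (_ `^ _); rewrite /r; field; rewrite !gt_eqF.
rewrite /arc_density /GRing.scale/= opprB.
field; rewrite !gt_eqF ?powR_gt0//.
Qed.

Lemma redheffer_cospq (x : R) : 0 < x < pipq p q ->
  (pipq p q ^+ 2 - x ^+ 2) / (pipq p q ^+ 2 + x ^+ 2)
    < cospq p q (x / 2) `^ (p - 1).
Proof.
move=> /andP[x0 xpi]; have a0 := Fpq1_gt0 p q p1 q1; have pi0 := @pi_gt0 R.
have [s s01 Fs] := Fpq_onto p q p1 q1 (x / 2) ltac:(rewrite /pipq in xpi; lra).
have /andP[s0 s1] := s01; have /andP[sq0 sq1] := powR_itv_oo01 q s q0 s01.
pose c := (1 - s `^ q) `^ r^-1.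
have u0 : 0 < 1 - s `^ q by rewrite subr_gt0.
have /andP[c0 c1] : 0 < c < 1.
  by apply: powR_itv_oo01; rewrite ?invr_gt0// u0 gtrBl.
(* The angle is acos c, where c = (1 - s^q)^(1/r) and F(s) = x/2; the exponents match because (p -
   1)/p = 1/r. *)
have cosE : cos (acos c) = c by rewrite acosK// in_itv/=; lra.
have t01 : 0 < acos c < pi / 2.
  rewrite acos_gt0/=; last by lra.
  rewrite -ltr_cos ?cos_pihalf ?cosE// in_itv/=; last by lra.
  by rewrite acos_ge0 ?acos_lepi ?(ltW c1) ?(le_trans _ (ltW c0)) ?lerN10.
have -> : cospq p q (x / 2) `^ (p - 1) = cos (acos c).
  rewrite -Fs cospq_Fpq// cosE /c -powRrM rVE; congr (_ `^ _).
  by field; rewrite gt_eqF.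
have Zt : Z (acos c) = q / r * (x / 2).
  rewrite /Z cos_conjE// cosE /c -powRrM mulVf ?gt_eqF// powRr1 ?(ltW u0)//.
  by rewrite subKr -powRrM mulfV ?gt_eqF// powRr1 ?(ltW s0)// Fs.
have Z0 : Z 0 = 0 by rewrite /Z cos_conj0 ?invr_gt0// Fpq0 mulr0.
have b2 : 2^-1 <= 1 - q^-1.
  by rewrite lerBrDr -lerBrDl [leRHS](_ : _ = 2^-1) ?lef_pV2 ?posrE//; field.
(* Both sides are reciprocals: 1 - 1/r = 1/p and 1 - 1/q = 1/(q/(q - 1)). *)
have br : 1 - r^-1 <= 1 - q^-1.
  rewrite rVE subKr -[1 - _](_ : (q / (q - 1))^-1 = _).
    by rewrite lef_pV2 ?posrE ?divr_gt0 ?subr_gt0.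
  by rewrite invf_div mulrBl mulfV ?gt_eqF// mul1r.
have := arc_ge_chord r (1 - q^-1) Z r1 b2 br Z_continuous Z0 is_derive_Z (acos c) t01.
rewrite Zt {1}/Z cos_conj_pihalf// -mulrA ler_pM2l ?divr_gt0// => chord.
have := redheffer_cos_of_chord _ _ _ t01 a0 chord.
rewrite /pipq; congr (_ < _).
(* Since pi_{p,q} = 2 F(1) and x = 2 (x/2), numerator and denominator both scale by 4. *)
rewrite [RHS](_ : _ = (4 * (Fpq p q 1 ^+ 2 - (x / 2) ^+ 2)) /
  (4 * (Fpq p q 1 ^+ 2 + (x / 2) ^+ 2))).
  by rewrite -mulf_div mulfV// mul1r.
by congr (_ / _); field.
Qed.

End redheffer.

Theorem theorem3p12 (R : realType) :
  (forall q p : R, 2 <= q -> q / (q - 1) <= p ->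
    forall x : R, 0 < x < pipq p q ->
      (pipq p q ^+ 2 - x ^+ 2) / (pipq p q ^+ 2 + x ^+ 2)
        < cospq p q (x / 2) `^ (p - 1)) /\
  (forall p : R, 2 <= p ->
    forall x : R, 0 < x < pip p ->
      (pip p ^+ 2 - x ^+ 2) / (pip p ^+ 2 + x ^+ 2)
        < cosp p (x / 2) `^ (p - 1)).
Proof.
split=> [q p q2 pq x|p p2 x]; first exact: redheffer_cospq.
apply: redheffer_cospq => //.
(* For q = p the condition is p <= p (p - 1), which follows from 2 <= p. *)
by rewrite ler_pdivrMr; [nra|lra].
Qed.
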